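(* Let $B$ be a finite Boolean lattice and $F$ a sheaf on $B$. Then $$\mathrm{HS}_*(B\setminus\mathbf{0};F)\cong\mathrm{HC}_*(B\setminus\mathbf{0};F).$$
   Context: $B$ is the lattice of all subsets of a finite set $A=\{a_1,\dots,a_n\}$ ordered by inclusion, with minimum $\mathbf{0}=\varnothing$; $B\setminus\mathbf{0}$ is $B$ with $\varnothing$ removed. A sheaf $F$ on a poset $P$ assigns an $R$-module $F(x)$ ($R$ commutative with $1$) to each $x\in P$ and a homomorphism $F^y_x:F(y)\to F(x)$ to each $x\le y$, functorially (contravariant functor); sheaves restrict to subposets. Sheaf homology $\mathrm{HS}_*(P;F)$ of a finite poset $P$ is the homology of the complex $S_n(P;F)=\bigoplus_\sigma F(x_0)$, sum over chains $\sigma=(x_n\le\cdots\le x_0)$ in $P$, with $d(s_\sigma)=F^{x_0}_{x_1}(s)_{d_0\sigma}+\sum_{i=1}^n(-1)^is_{d_i\sigma}$ ($s_\sigma$ is $s\in F(x_0)$ in the summand indexed by $\sigma$; $d_i\sigma$ omits $x_i$); equivalently the left derived functors of colimit. Cellular homology of $B\setminus\mathbf{0}$: $\mathrm{HC}_*(B\setminus\mathbf{0};F)$ is the homology of the complex with $C_k=\bigoplus_{|y|=k+1}F(y)$ (sum over subsets $y$ of size $k+1$) and differential $d=\sum\varepsilon^y_wF^y_w$ over pairs $w\subset y$ of nonempty subsets with $|w|=|y|-1$, where $\varepsilon^y_w=(-1)^{j-1}$ if $y=\{a_{i_1},\dots,a_{i_m}\}$ with $i_1<\cdots<i_m$ and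 $w=y\setminus\{a_{i_j}\}$. *)

(* Defs.v *)
From HB Require Import structures.
From mathcomp Require Import all_boot all_order all_algebra.
Set Implicit Arguments. Unset Strict Implicit. Unset Printing Implicit Defensive.
Import GRing.Theory.
Local Open Scope ring_scope.

(* The Boolean lattice B is the powerset of A = 'I_n = {a_1,...,a_n}
   (a_i is the ordinal i-1), ordered by inclusion. *)

(* A sheaf of R-modules on B: a module F x for every subset x, and linear
   restriction maps F^y_x : F y -> F x.  The map sres x y is only meaningful
   (and only ever used) when x \subset y; functoriality is required there. *)
Record sheaf (R : pzRingType) (n : nat) := Sheaf {
  sF : {set 'I_n} -> lmodType R;
  sres : forall x y : {set 'I_n}, {linear sF y -> sF x};
  sres_id : forall x (s : sF x), sres x x s = s;
  sres_comp : forall x y z : {set 'I_n}, x \subset y -> y \subset z ->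
     forall s : sF z, sres x y (sres y z s) = sres x z s }.

Section Homology.
Variable R : pzRingType.

(* Pointwise operations on dependent functions (= elements of a direct sum,
   once restricted to finitely supported families). *)
Section DP.
Variables (I : Type) (M : I -> lmodType R).
Definition dadd (f g : forall i, M i) : forall i, M i := fun i => f i + g i.
Definition dsub (f g : forall i, M i) : forall i, M i := fun i => f i - g i.
Definition dscale (a : R) (f : forall i, M i) : forall i, M i := fun i => a *: f i.
End DP.

(* hiso ZX BX ZY BY : the quotient R-modules ZX/BX and ZY/BY are isomorphic.
   Expressed through a set-theoretic lift f of the isomorphism to
   representatives: f maps cycles to cycles, induces a well-defined injective
   map on classes, is R-linear modulo boundaries, and is surjective on classes. *)
Definition hiso (I J : Type) (M : I -> lmodType R) (N : J -> lmodType R)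
  (ZX BX : (forall i, M i) -> Prop) (ZY BY : (forall j, N j) -> Prop) : Prop :=
  exists f : (forall i, M i) -> (forall j, N j),
    [/\ forall x, ZX x -> ZY (f x),
        forall x x', ZX x -> ZX x' -> (BY (dsub (f x) (f x')) <-> BX (dsub x x')),
        forall a x x', ZX x -> ZX x' ->
           BY (dsub (f (dadd (dscale a x) x')) (dadd (dscale a (f x)) (f x')))
      & forall y, ZY y -> exists2 x, ZX x & BY (dsub (f x) y)].

Variables (n : nat) (F : sheaf R n).

(* A k-chain sigma = (x_k <= ... <= x_0) of nonempty subsets, stored as
   c : 'I_(k+1) -> {set 'I_n} with c i = x_i. *)
Definition schain (k : nat) := {ffun 'I_k.+1 -> {set 'I_n}}.
Definition is_chain k (c : schain k) : bool :=
  [forall i, c i != set0] &&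
  [forall i : 'I_k.+1, forall j : 'I_k.+1, (i <= j)%N ==> (c j \subset c i)].
Definition face k (i : 'I_k.+2) (c : schain k.+1) : schain k :=
  [ffun j => c (lift i j)].

(* S_k(B\0;F) = direct sum over k-chains sigma of F(x_0) *)
Definition Selt k := forall c : schain k, sF F (c ord0).
Definition S_supp k (z : Selt k) : Prop := forall c, ~~ is_chain c -> z c = 0.
(* d(s_sigma) = F^{x_0}_{x_1}(s)_{d_0 sigma} + sum_{i>=1} (-1)^i s_{d_i sigma} *)
Definition Sd k (z : Selt k.+1) : Selt k := fun t =>
  \sum_(i < k.+2) \sum_(s : schain k.+1 | is_chain s && (face i s == t))
     ((-1) ^+ i) *: sres F (t ord0) (s ord0) (z s).
Definition SZ k (z : Selt k) : Prop :=
  S_supp z /\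
  (match k return Selt k -> Prop with
   | 0 => fun _ => True
   | k'.+1 => fun z => forall t, Sd z t = 0
   end) z.
Definition SB k (z : Selt k) : Prop :=
  exists y : Selt k.+1, S_supp y /\ forall t, Sd y t = z t.

(* C_k = direct sum over subsets y with |y| = k+1 of F(y) *)
Definition Celt := forall y : {set 'I_n}, sF F y.
Definition C_supp (k : nat) (z : Celt) : Prop := forall y : {set 'I_n}, #|y| != k.+1 -> z y = 0.
(* d = sum eps^y_w F^y_w, with w = y \ {a}, eps^y_w = (-1)^(j-1) where a is the
   j-th element of y, i.e. j-1 = #{b in y | b < a}. *)
Definition Cd (k : nat) (z : Celt) : Celt := fun w =>
  \sum_(y : {set 'I_n} | #|y| == k.+2)
    \sum_(a in y | w == y :\ a)
       ((-1) ^+ #|[set b in y | (b < a)%N]|) *: sres F w y (z y).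
Definition CZ (k : nat) (z : Celt) : Prop :=
  C_supp k z /\ (match k with 0 => True | k'.+1 => forall w, Cd k' z w = 0 end).
Definition CB (k : nat) (z : Celt) : Prop :=
  exists y, C_supp k.+1 y /\ forall w, Cd k y w = z w.

(* HS_k and HC_k are the quotients SZ k / SB k and CZ k / CB k. *)
End Homology.

(* Main.v *)
Require Import Defs.
From HB Require Import structures.
From mathcomp Require Import all_boot all_order all_algebra.
From mathcomp Require Import ring.
Set Implicit Arguments. Unset Strict Implicit. Unset Printing Implicit Defensive.
Import GRing.Theory.
Local Open Scope ring_scope.

(** Acyclic carriers.  Sending a subset to its least element induces a chain map
    psi from the simplicial to the cellular complex: x_0 >= ... >= x_k goes to
    {min x_0, ..., min x_k}, or to 0 if two minima coincide.  In the other
    direction phi is barycentric subdivision, defined recursively by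
    phi y = cone_y (phi (d y)).  Then psi phi = id, because the only flag of y
    with distinct minima removes the minimum at each step.  The recursion
    D s = cone_(x_0) (s - phi psi s - D (d s)) gives a homotopy from phi psi to
    the identity.  All these maps have coefficients in R and send the summand of x
    to summands of subsets of x, so they act on coefficients in any sheaf, and the
    identities need only be checked on matrices.

    The matrices are indexed by sequences of subsets, with the empty sequence (and
    the empty subset) playing the role of the augmentation; this makes
    d (cone_x w) = w - cone_x (d w) hold in every degree. *)

(** * Formal sums of sequences: faces, boundaries, cones and finite summation *)

Section Sequences.
Variables (R : comPzRingType) (T : finType).
Implicit Types (s t : seq T) (g w : seq T -> R).

(** The recursion separates the face omitting the head from the faces keeping it, so that the
    identities below become inductions on the sequence; [facesumE] recovers the usual alternating
    sum. *)
Fixpoint facesum g s : R :=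
  if s is x :: s' then g s' - facesum (fun r => g (x :: r)) s' else 0.

(* The coefficient of [t] in the boundary of the formal sum with coefficients [w];
   [facesum] is the dual operation on cochains. *)
Fixpoint bdry w t : R :=
  (\sum_x w (x :: t)) - (if t is y :: t' then bdry (fun r => w (y :: r)) t' else 0).

(** Replaces a sum over a finite index type, since [seq T] is infinite; [sum_seq_of] translates
    between the two. *)
Fixpoint ssum (m : nat) g : R :=
  if m is m'.+1 then \sum_x ssum m' (fun r => g (x :: r)) else g [::].

Definition del (i : nat) s := take i s ++ drop i.+1 s.

Lemma size_del i s : (i < size s)%N -> (size (del i s)).+1 = size s.
Proof.
move=> ilt; rewrite size_cat size_takel 1?ltnW // size_drop -addnS subnSK //.
by rewrite subnKC // ltnW.
Qed.

Lemma facesumE g s : facesum g s = \sum_(i < size s) (-1) ^+ i * g (del i s).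
Proof.
elim: s g => [|x s IH] g /=; first by rewrite big_ord0.
rewrite big_ord_recl expr0 mul1r /del /= drop0; congr (_ + _).
by rewrite IH -sumrN; apply: eq_bigr => i _; rewrite exprS mulN1r mulNr.
Qed.

Lemma eq_facesum g g' s :
  (forall i, (i < size s)%N -> g (del i s) = g' (del i s)) ->
  facesum g s = facesum g' s.
Proof. by move=> E; rewrite !facesumE; apply: eq_bigr => i _; rewrite E. Qed.

Lemma facesum_neq0 g s : facesum g s != 0 ->
  exists2 i, (i < size s)%N & g (del i s) != 0.
Proof.
move=> nz; have [/existsP[i gi]|/existsPn E] :=
  boolP [exists i : 'I_(size s), g (del i s) != 0].
  by exists (i : nat).
case/eqP: nz; rewrite facesumE big1 // => i _.
by have /negPn/eqP-> := E i; rewrite mulr0.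
Qed.

Lemma facesumB g g' s :
  facesum (fun r => g r - g' r) s = facesum g s - facesum g' s.
Proof.
rewrite !facesumE -sumrB; apply: eq_bigr => i _; by rewrite mulrBr.
Qed.

Lemma facesum_sum (I : finType) (G : I -> seq T -> R) s :
  facesum (fun r => \sum_i G i r) s = \sum_i facesum (G i) s.
Proof.
rewrite facesumE.
under eq_bigr do rewrite mulr_sumr.
rewrite exchange_big; apply: eq_bigr => i _; by rewrite facesumE.
Qed.

Lemma facesumMr g c s : facesum (fun r => g r * c) s = facesum g s * c.
Proof. by rewrite !facesumE mulr_suml; apply: eq_bigr => i _; rewrite mulrA. Qed.

Lemma facesumMl g c s : facesum (fun r => c * g r) s = c * facesum g s.
Proof. by rewrite !facesumE mulr_sumr; apply: eq_bigr => i _; rewrite mulrCA. Qed.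

(** Splitting off the head twice, the two copies of [facesum g s] cancel, and the rest is the same
    claim for the shorter sequence. *)
Lemma facesum_facesum g s : facesum (facesum g) s = 0.
Proof.
elim: s g => [|x s IH] g //=.
by rewrite facesumB IH subr0 subrr.
Qed.

Lemma eq_bdry w w' t : w =1 w' -> bdry w t = bdry w' t.
Proof.
elim: t w w' => [|y t IH] w w' E /=.
  by congr (_ - _); apply: eq_bigr => x _; rewrite E.
congr (_ - _); first by apply: eq_bigr => x _; rewrite E.
by apply: IH => r; rewrite E.
Qed.

Lemma bdry_sum (I : finType) (P : pred I) (W : I -> seq T -> R) (c : I -> R) t :
  bdry (fun r => \sum_(i | P i) c i * W i r) t =
  \sum_(i | P i) c i * bdry (W i) t.
Proof.
elim: t W => [|y t IH] W /=.
  rewrite exchange_big /= subr0; apply: eq_bigr => i _.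
  by rewrite subr0 mulr_sumr.
rewrite IH exchange_big /= -sumrB; apply: eq_bigr => i _.
by rewrite mulrBr mulr_sumr.
Qed.

Lemma bdryB w w' t : bdry (fun r => w r - w' r) t = bdry w t - bdry w' t.
Proof.
elim: t w w' => [|y t IH] w w' /=; first by rewrite !subr0 sumrB.
by rewrite IH sumrB; ring.
Qed.

Lemma bdryZ c w t : bdry (fun r => c * w r) t = c * bdry w t.
Proof.
elim: t w => [|y t IH] w /=; first by rewrite !subr0 mulr_sumr.
by rewrite IH mulrBr mulr_sumr.
Qed.

Lemma bdry0 t : bdry (fun=> 0) t = 0.
Proof.
elim: t => [|y t IH] /=; rewrite big1 //; first by rewrite subr0.
by rewrite IH subr0.
Qed.

(** The two operators act on different arguments of [K], hence commute. *)
Lemma bdry_facesum (K : seq T -> seq T -> R) s t :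
  bdry (fun r => facesum (fun q => K q r) s) t =
  facesum (fun q => bdry (K q) t) s.
Proof.
elim: s K => [|x s IH] K /=; first exact: bdry0.
by rewrite bdryB IH.
Qed.

Definition cone x w s : R := if s is y :: s' then (y == x)%:R * w s' else 0.

(** Omitting the added vertex returns [w]; omitting any other vertex commutes with prepending [x],
    up to a sign. *)
Lemma bdry_cone x w t : bdry (cone x w) t = w t - cone x (bdry w) t.
Proof.
have E q : \sum_y cone x w (y :: q) = w q.
  rewrite (bigD1 x) //= eqxx mul1r big1 ?addr0 // => y /negPf->.
  by rewrite mul0r.
by case: t => [|y t] /=; rewrite -/(cone x w) [X in X - _]E // bdryZ.
Qed.

(** The basis vector of [x :: s] is the cone from [x] over that of [s], so [bdry_cone] reproduces
    the recursive clause of [facesum]. *)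
Lemma bdry_delta s t : bdry (fun r => (s == r)%:R) t = facesum (fun r => (r == t)%:R) s.
Proof.
elim: s t => [|x s IH] t.
  have -> : bdry (fun r => ([::] == r)%:R) t = bdry (fun=> 0) t.
    by case: t => [|y t] /=; rewrite !big1 ?bdry0.
  exact: bdry0.
have -> : bdry (fun r => (x :: s == r)%:R) t = bdry (cone x (fun r => (s == r)%:R)) t.
  apply: eq_bdry => -[|y r] //=.
  by rewrite eqseq_cons eq_sym -mulnb natrM.
rewrite bdry_cone /=; congr (_ - _); case: t => [|y t] /=.
  by rewrite facesumE big1 // => i _; rewrite mulr0.
rewrite IH -facesumMl; apply: eq_facesum => i _.
by rewrite eqseq_cons eq_sym -mulnb natrM.
Qed.

Lemma eq_ssum m g g' : (forall s, size s = m -> g s = g' s) -> ssum m g = ssum m g'.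
Proof.
elim: m g g' => [|m IH] g g' E /=; first exact: E.
by apply: eq_bigr => x _; apply: IH => s zs; apply: E => /=; rewrite zs.
Qed.

Lemma ssumMl m c g : ssum m (fun s => c * g s) = c * ssum m g.
Proof.
elim: m g => [|m IH] g //=.
by rewrite mulr_sumr; apply: eq_bigr => x _; rewrite IH.
Qed.

Lemma ssumS m g : ssum m.+1 g = \sum_x ssum m (fun r => g (x :: r)).
Proof. by []. Qed.

Lemma ssumB m g g' : ssum m (fun s => g s - g' s) = ssum m g - ssum m g'.
Proof.
elim: m g g' => [|m IH] g g' //=.
by rewrite -sumrB; apply: eq_bigr => x _; rewrite IH.
Qed.

Lemma ssum_sum m (I : finType) (P : pred I) (G : I -> seq T -> R) :
  ssum m (fun s => \sum_(i | P i) G i s) = \sum_(i | P i) ssum m (G i).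
Proof.
elim: m G => [|m IH] G //=.
under eq_bigr do rewrite IH.
by rewrite exchange_big.
Qed.

Lemma ssum_delta g t : ssum (size t) (fun s => (t == s)%:R * g s) = g t.
Proof.
elim: t g => [|y t IH] g /=; first by rewrite mul1r.
rewrite (bigD1 y) //= [X in _ + X]big1 ?addr0 => [|x /negPf nxy].
  by rewrite -(IH (fun s => g (y :: s))); apply: eq_ssum => s _; rewrite eqseq_cons eqxx.
rewrite -[RHS](mul0r (ssum (size t) (fun=> 0))) -ssumMl.
by apply: eq_ssum => s _; rewrite eqseq_cons eq_sym nxy !mul0r.
Qed.

(** Row sums of the face matrix; every face of [x :: s] has length [size s], so the sum meets all of
    them. *)
Lemma ssum_facesum g x s :
  ssum (size s) (fun r => facesum (fun q => (q == r)%:R) (x :: s) * g r) =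
  facesum g (x :: s).
Proof.
rewrite [RHS]facesumE.
transitivity (ssum (size s) (fun r => \sum_(i < (size s).+1)
    (-1) ^+ i * ((del i (x :: s) == r)%:R * g r))).
  apply: eq_ssum => r _; rewrite facesumE mulr_suml.
  by apply: eq_bigr => i _; rewrite mulrA.
rewrite ssum_sum; apply: eq_bigr => i _; rewrite ssumMl; congr (_ * _).
have [zd] := @size_del i (x :: s) (ltn_ord i).
by rewrite -[in RHS](ssum_delta g) zd.
Qed.

(** The corresponding column sums: only sequences one longer than [t] have [t] as a face. *)
Lemma ssum_bdry w t :
  ssum (size t).+1 (fun s => w s * facesum (fun r => (r == t)%:R) s) = bdry w t.
Proof.
elim: t w => [|y t IH] w.
  by rewrite /= !subr0; apply: eq_bigr => x _; rewrite mulr1.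
(* A face of [x :: s] equal to [y :: t] is either [s] itself, or keeps the head [x = y] and comes
   from a face of [s] equal to [t]. *)
have E x s : facesum (fun r => (r == y :: t)%:R) (x :: s) =
    (y :: t == s)%:R - (y == x)%:R * facesum (fun r => (r == t)%:R) s.
  rewrite /= eq_sym; congr (_ - _); rewrite -facesumMl.
  by apply: eq_facesum => i _; rewrite eqseq_cons eq_sym -mulnb natrM.
transitivity (\sum_x (ssum (size t).+1 (fun s => (y :: t == s)%:R * w (x :: s)) -
    (y == x)%:R * ssum (size t).+1 (fun s => w (x :: s) * facesum (fun r => (r == t)%:R) s))).
  rewrite [LHS]ssumS; apply: eq_bigr => x _; rewrite -ssumMl -ssumB.
  by apply: eq_ssum => s _; rewrite E; ring.
rewrite sumrB; congr (_ - _).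
  by apply: eq_bigr => x _; rewrite -(ssum_delta (fun s => w (x :: s)) (y :: t)).
rewrite (bigD1 y) //= eqxx mul1r [X in _ + X]big1 ?addr0 => [|x].
  exact: IH.
by rewrite eq_sym => /negPf->; rewrite mul0r.
Qed.

End Sequences.

(** * The augmented cellular boundary on subsets *)

Section Subsets.
Variables (R : comPzRingType) (n : nat).
Local Notation T := {set 'I_n}.
Implicit Types (x y : T) (s t : seq T) (a b : 'I_n).

Definition incidence_sign y a : R := (-1) ^+ #|[set b in y | (b < a)%N]|.

(** The sign of the cellular differential extended by 0 to all pairs, in the shape of the inner sum
    of [Cd]; at most one [a] contributes. *)
Definition incidence y w : R := \sum_(a in y | w == y :\ a) incidence_sign y a.

Lemma sum_incidence y (G : T -> R) :
  \sum_w incidence y w * G w = \sum_(a in y) incidence_sign y a * G (y :\ a).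
Proof.
rewrite [RHS](eq_bigr (fun a => \sum_(w | w == y :\ a) incidence_sign y a * G w)).
  rewrite (exchange_big_dep predT) //=; apply: eq_bigr => w _.
  by rewrite mulr_suml; apply: eq_bigl.
by move=> a _; rewrite big_pred1_eq.
Qed.

(** The subsets with facet [w] are the [a |: w], and adding [a] does not change the number of
    elements below [a]. *)
Lemma sum_coincidence w (G : T -> R) :
  \sum_y G y * incidence y w =
  \sum_(a | a \notin w) incidence_sign w a * G (a |: w).
Proof.
rewrite [RHS](eq_bigr (fun a => \sum_(y | y == a |: w) G y * incidence_sign y a)).
  rewrite (exchange_big_dep predT) //=; apply: eq_bigr => y _.
  rewrite mulr_sumr; apply: eq_bigl => a.
  apply/andP/andP => [[ay /eqP->]|[aw /eqP->]].
    by rewrite setD11 setD1K.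
  by rewrite setU11 setU1K.
move=> a aw; rewrite big_pred1_eq mulrC; congr (_ * _ ^+ _).
apply: eq_card => b; rewrite !inE; case: eqP => //= ->.
by rewrite (negPf aw) ltnn.
Qed.

(** Removing [a] lowers by one the number of elements below [b], while removing [b] does not affect
    those below [a]. *)
Lemma incidence_sign_swap y a b : a \in y -> b \in y -> (a < b)%N ->
  incidence_sign y a * incidence_sign (y :\ a) b =
  - (incidence_sign y b * incidence_sign (y :\ b) a).
Proof.
move=> ay yb ab.
have -> : incidence_sign (y :\ b) a = incidence_sign y a.
  congr (_ ^+ _); apply: eq_card => c; rewrite !inE.
  by case: eqP => //= ->; rewrite ltnNge (ltnW ab) andbF.
suff -> : incidence_sign y b = - incidence_sign (y :\ a) b by ring.
rewrite /incidence_sign (cardsD1 a) !inE ay ab exprD expr1 mulN1r.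
by congr (- _ ^+ _); apply: eq_card => c; rewrite !inE andbA.
Qed.

Lemma sum_incidence_incidence y (G : T -> R) :
  \sum_(a in y) incidence_sign y a *
    (\sum_(b in y :\ a) incidence_sign (y :\ a) b * G (y :\ a :\ b)) = 0.
Proof.
pose H a b := incidence_sign y a * incidence_sign (y :\ a) b * G (y :\ a :\ b).
(* Splitting by the order of the pair lets the half with [b < a] be renamed and cancelled against
   the other. *)
transitivity (\sum_(a in y) \sum_(b in y)
    ((if (a < b)%N then H a b else 0) + (if (b < a)%N then H a b else 0))).
  apply: eq_bigr => a ya; rewrite mulr_sumr [RHS](bigD1 a) //= !ltnn !addr0 add0r.
  apply: eq_big => [b|b]; rewrite !inE 1?andbC // => /andP[_ +].
  by rewrite -val_eqE /= mulrA -/(H a b); case: ltngtP; rewrite ?addr0 ?add0r.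
under eq_bigr do rewrite big_split.
rewrite big_split /= [X in _ + X]exchange_big -big_split big1 // => a ya.
rewrite -big_split big1 // => b yb /=.
case: ltnP => ab; last by rewrite addr0.
rewrite /H incidence_sign_swap // mulNr.
suff -> : y :\ a :\ b = y :\ b :\ a by rewrite addNr.
by apply/setP => c; rewrite !inE andbCA.
Qed.

(** * Least elements, and the coefficients of psi and phi *)

Definition ismin a x := (a \in x) && [forall b in x, (a <= b)%N].

Lemma ismin_inj x a b : ismin a x -> ismin b x -> a = b.
Proof.
move=> /andP[xa /forall_inP ma] /andP[xb /forall_inP mb].
by apply/val_inj/eqP; rewrite eqn_leq ma ?mb.
Qed.

Lemma ismin_exists x : x != set0 -> exists a, ismin a x.
Proof.
case/set0Pn => a xa; case: (@arg_minnP _ a (mem x) (fun b => b : nat) xa) => b xb mb.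
by exists b; apply/andP; split=> //; apply/forall_inP.
Qed.

Lemma incidence_sign_min x a : ismin a x -> incidence_sign x a = 1.
Proof.
case/andP=> xa /forall_inP ma; rewrite /incidence_sign.
suff -> : [set b in x | (b < a)%N] = set0 by rewrite cards0.
by apply/setP => b; rewrite !inE; case: (boolP (b \in x)) => //= /ma; rewrite ltnNge => ->.
Qed.

(* The coefficient of [y] in [psi s], of [t] in [phi y], and (below) of [t] in [D s]. *)
Fixpoint minvertex s y : R :=
  if s is x :: s' then \sum_(a | ismin a x && ismin a y) minvertex s' (y :\ a)
  else (y == set0)%:R.

Fixpoint subdivision y t : R :=
  if t is x :: t' then
    (x == y)%:R * \sum_(a in y) incidence_sign y a * subdivision (y :\ a) t'
  else (y == set0)%:R.

Definition chain s := all (fun x => x != set0) s && sorted (fun x y => y \subset x) s.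

(** With the default [set0], the empty sequence is treated uniformly in [chain_cons] and in the
    support lemmas. *)
Definition top s := head set0 s.

Lemma chain_cons x s : chain (x :: s) = [&& x != set0, top s \subset x & chain s].
Proof.
rewrite /chain /top; case: s => [|y s] /=; first by rewrite sub0set !andbT.
by rewrite -!andbA; do !bool_congr.
Qed.

Lemma del_cons i x s : del i.+1 (x :: s) = x :: del i s.
Proof. by []. Qed.

Lemma chain_del i s : (i < size s)%N -> chain s ->
  chain (del i s) /\ top (del i s) \subset top s.
Proof.
elim: i s => [|i IH] [|x s] //=; first by rewrite /del /= drop0 chain_cons => _ /and3P[].
rewrite ltnS del_cons !chain_cons => /IH {}IH /and3P[-> sx /IH[-> ds]].
by split; rewrite //= andbT (subset_trans ds).
Qed.

(** The elements removed from [y] one by one are the minima of the entries of [s], and all entries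
    lie in the top. *)
Lemma minvertex_neq0 s y : chain s -> minvertex s y != 0 ->
  #|y| = size s /\ y \subset top s.
Proof.
elim: s y => [|x s IH] y.
  by move=> _ /=; case: (y =P set0) => [->|_]; rewrite ?eqxx ?cards0 ?sub0set.
rewrite chain_cons => /and3P[_ sx cs] /= nz.
have [/existsP[a /andP[/andP[ax ay] nza]]|/existsPn E] :=
    boolP [exists a, ismin a x && ismin a y && (minvertex s (y :\ a) != 0)].
  have [<- ys] := IH _ cs nza; case/andP: ay => ya _; case/andP: ax => xa _.
  split; first by rewrite [LHS](cardsD1 a) ya.
  by rewrite -(setD1K ya) subUset sub1set xa (subset_trans ys).
case/eqP: nz; apply: big1 => a Ha.
by have := E a; rewrite Ha /= negbK => /eqP.
Qed.

(** Only the flags that start at [y] and lose one element at each step occur in phi [y]. *)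
Lemma subdivision_neq0 y t : subdivision y t != 0 ->
  [/\ chain t, top t = y & #|y| = size t].
Proof.
elim: t y => [|x t IH] y /=.
  by case: (y =P set0) => [->|_]; rewrite ?eqxx ?cards0.
have [->|] := eqVneq x y; last by rewrite mul0r eqxx.
rewrite mul1r => nz.
have [/existsP[a /andP[ya nza]]|/existsPn E] :=
    boolP [exists a, (a \in y) && (subdivision (y :\ a) t != 0)].
  have [ct tt zt] := IH _ nza.
  split=> //; last by rewrite (cardsD1 a) ya zt.
  by rewrite chain_cons ct tt subD1set !andbT; apply/set0Pn; exists a.
case/eqP: nz; apply: big1 => a ya.
by have := E a; rewrite ya /= negbK => /eqP->; rewrite mulr0.
Qed.

Lemma minvertex_cons x s y m : ismin m x ->
  minvertex (x :: s) y = (ismin m y)%:R * minvertex s (y :\ m).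
Proof.
move=> mx /=; case: (boolP (ismin m y)) => my.
  rewrite mul1r (big_pred1 m) // => a.
  apply/andP/eqP => [[ax _]|-> //]; exact: ismin_inj ax mx.
rewrite mul0r big1 // => a /andP[ax ay].
by rewrite (ismin_inj mx ax) ay in my.
Qed.

(** psi commutes with the boundaries. By induction on the chain, comparing the positions in [w] of
    the least element [m] of the head. *)
Lemma minvertex_chain_map s w : chain s ->
  facesum (fun r => minvertex r w) s = \sum_y minvertex s y * incidence y w.
Proof.
rewrite sum_coincidence; elim: s w => [|x s IH] w.
  by move=> _ /=; rewrite big1 // => a _; rewrite setU_eq0 -cards_eq0 cards1 mulr0.
rewrite chain_cons => /and3P[/ismin_exists[m mx] sx cs].
have [xm /forall_inP lem] := andP mx.
(* The support of psi [s] lies in subsets of [x], which has nothing below [m]. *)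
have nz0 y b : b \in y -> (b < m)%N -> minvertex s y = 0.
  move=> yb bm; apply: contraTeq bm => /(minvertex_neq0 cs)[_ ys].
  by rewrite -leqNgt lem // (subsetP sx) // (subsetP ys).
transitivity (minvertex s w - (ismin m w)%:R *
    \sum_(a | a \notin w :\ m) incidence_sign (w :\ m) a * minvertex s (a |: (w :\ m))).
  rewrite -[LHS]/(minvertex s w - facesum (fun r => minvertex (x :: r) w) s).
  rewrite -IH // -facesumMl; congr (_ - _).
  by apply: eq_facesum => i _; rewrite (minvertex_cons _ _ mx).
under [RHS]eq_bigr do rewrite (minvertex_cons _ _ mx).
(* If [m] is outside [w], only [a = m] can make it least in [a |: w]. If [m] is not below all of
   [w], then [w] is not inside the top of [s] and both sides vanish. *)
have [wm|wm] := boolP (m \in w); last first.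
  rewrite /ismin (negPf wm) /= mul0r subr0 (bigD1 m) //= setU1K //.
  rewrite [X in _ + X]big1 ?addr0 => [|a /andP[aw am]]; last first.
    by rewrite !inE (negPf wm) orbF eq_sym (negPf am) /= mul0r mulr0.
  rewrite setU11 /=; case: forall_inP => [mw|nmw].
    rewrite mul1r (_ : incidence_sign w m = 1) ?mul1r //.
    rewrite -[RHS](@incidence_sign_min (m |: w) m).
      congr (_ ^+ _); apply: eq_card => b; rewrite !inE.
      by case: eqP => // ->; rewrite ltnn !andbF.
    by rewrite /ismin setU11; apply/forall_inP.
  rewrite mul0r mulr0; apply/eqP; apply: contra_notT nmw => /(minvertex_neq0 cs)[_ ws] b.
  rewrite !inE => /predU1P[-> //|wb].
  by rewrite lem // (subsetP sx) // (subsetP ws).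
(* If [m] is in [w] but not least, enlarging [w] cannot make it least, and [nz0] kills the left
   side. *)
case: (boolP (ismin m w)) => mw; last first.
  rewrite mul0r subr0 [RHS]big1 => [|a aw].
    case: (boolP [exists b in w, (b < m)%N]) => [/exists_inP[b wb bm]|].
      exact: nz0 wb bm.
    rewrite negb_exists => /forallP E; case/negP: mw; rewrite /ismin wm.
    by apply/forall_inP => b wb; have := E b; rewrite wb /= -leqNgt.
  rewrite (_ : ismin m (a |: w) = false) ?mul0r ?mulr0 //.
  apply: contraNF mw => /andP[_ /forall_inP E]; rewrite /ismin wm.
  by apply/forall_inP => b wb; apply: E; rewrite inE wb orbT.
(* If [m] is least in [w], the term [a = m] cancels [minvertex s w]. Elements below [m] contribute 0
   by [nz0]; for those above, the presence of [m] flips the sign. *)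
rewrite mul1r (bigD1 m) ?setD11 //= setD1K //.
have -> : incidence_sign (w :\ m) m = 1.
  rewrite -(incidence_sign_min mw); congr (_ ^+ _); apply: eq_card => b; rewrite !inE.
  by case: eqP => //= ->; rewrite ltnn andbF.
rewrite mul1r opprD addNKr -sumrN; apply: eq_big => [a|a].
  by rewrite !inE; case: eqP => [->|_] /=; rewrite ?wm ?andbT.
rewrite !inE => /andP[/nandP[/negPn/eqP->|aw am]]; first by rewrite eqxx.
have -> : (a |: w) :\ m = a |: (w :\ m).
  by apply/setP => b; rewrite !inE; case: (b =P a) => [->|_]; rewrite ?am.
have [ltma|] := ltnP m a; last first.
  rewrite leq_eqVlt val_eqE (negPf am) /= => ltam.
  by rewrite (nz0 _ a) ?setU11 // !mulr0 oppr0.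
rewrite (_ : ismin m (a |: w)) ?mul1r -?mulNr; last first.
  rewrite /ismin inE wm orbT; apply/forall_inP => b /setU1P[->|].
    exact: ltnW.
  by case/andP: mw => _ /forall_inP; apply.
congr (_ * _); rewrite /incidence_sign [in RHS](cardsD1 m) !inE wm ltma exprD expr1 mulN1r.
by congr (- _ ^+ _); apply: eq_card => b; rewrite !inE andbA.
Qed.

(** Since phi y = cone_y (phi (d y)), the cone formula gives d (phi y) = phi (d y) - cone_y (d (phi
    (d y))), and by induction the last term is cone_y (phi (d (d y))) = 0. *)
Lemma subdivision_chain_map y t :
  bdry (subdivision y) t = \sum_w incidence y w * subdivision w t.
Proof.
rewrite sum_incidence; elim: t y => [|z t IH] y.
  rewrite /= subr0 (bigD1 y) //= eqxx mul1r [X in _ + X]big1 ?addr0 // => x /negPf->.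
  by rewrite mul0r.
rewrite [LHS]/= bdryZ bdry_sum.
under [X in _ - _ * X]eq_bigr do rewrite IH.
rewrite (sum_incidence_incidence y (fun v => subdivision v t)) mulr0 subr0 (bigD1 y) //= eqxx mul1r.
by rewrite [X in _ + X]big1 ?addr0 // => x /negPf->; rewrite mul0r.
Qed.

Lemma minvertex_subdivision y w :
  ssum #|y| (fun t => subdivision y t * minvertex t w) = (y == w)%:R.
Proof.
move: {2}#|y| (erefl #|y|) => m; elim: m y w => [|m IH] y w zy; rewrite zy.
  move/eqP: zy; rewrite cards_eq0 => /eqP-> /=.
  by rewrite eqxx mul1r eq_sym.
have /ismin_exists[p py] : y != set0 by rewrite -cards_eq0 zy.
have [yp /forall_inP lep] := andP py.
rewrite ssumS (bigD1 y) //= [X in _ + X]big1 ?addr0; last first.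
  move=> x /negPf xy; transitivity (0 * ssum m (fun _ : seq T => 0 : R)); last by rewrite mul0r.
  by rewrite -ssumMl; apply: eq_ssum => s _; rewrite xy !mul0r.
transitivity (\sum_(a in y) (incidence_sign y a * (ismin p w)%:R) *
    ssum m (fun t => subdivision (y :\ a) t * minvertex t (w :\ p))).
  under [RHS]eq_bigr do rewrite -ssumMl.
  rewrite -ssum_sum; apply: eq_ssum => s _.
  rewrite eqxx mul1r -/(minvertex (y :: s) w) (minvertex_cons _ _ py) mulr_suml.
  by apply: eq_bigr => a _; ring.
transitivity (\sum_(a in y) (incidence_sign y a * (ismin p w)%:R) * (y :\ a == w :\ p)%:R : R).
  apply: eq_bigr => a ya.
  have za : #|y :\ a| = m by move: zy; rewrite (cardsD1 a) ya => -[].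
  by rewrite -(IH _ _ za) za.
(* For [a] other than [p], the element [p] lies in [y :\ a] but not in [w :\ p]: only removal of the
   minimum survives. *)
rewrite (bigD1 p) //= [X in _ + X]big1 ?addr0 => [|a /andP[ya ap]]; last first.
  rewrite (_ : (y :\ a == w :\ p) = false) ?mulr0 //.
  by apply/eqP => /setP/(_ p); rewrite !inE eqxx eq_sym ap yp.
rewrite incidence_sign_min // mul1r.
have [<-|nyw] := eqVneq y w; first by rewrite py eqxx mulr1.
case: (boolP (ismin p w)) => pw; last by rewrite mul0r.
rewrite (_ : (y :\ p == w :\ p) = false) ?mulr0 //.
apply: contraNF nyw => /eqP E; apply/eqP.
by rewrite -(setD1K yp) E setD1K //; case/andP: pw.
Qed.

(** * The homotopy between phi psi and the identity *)

(* The coefficient of [t] in [s - phi (psi s)]. *)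
Definition defect s t : R :=
  (s == t)%:R - \sum_y minvertex s y * subdivision y t.

(** The recursion is on the target [t]: a cone prepends one vertex, so the coefficient at [y :: t']
    only involves coefficients at [t'], and no termination argument on faces of [s] is required. *)
Fixpoint homotopy s t {struct t} : R :=
  if t is y :: t' then
    ((s != [::]) && (y == top s))%:R *
      (defect s t' - facesum (fun r => homotopy r t') s)
  else 0.

Lemma defect_nil t : defect [::] t = 0.
Proof.
rewrite /defect (bigD1 set0) //= eqxx mul1r [X in _ - (_ + X)]big1 ?addr0; last first.
  by move=> y /negPf->; rewrite mul0r.
case: t => [|y t] /=; first by rewrite eqxx subrr.
by rewrite sub0r big1 ?mulr0 ?oppr0 // => a; rewrite inE.
Qed.

Lemma defect_chain_map s t : chain s ->
  bdry (defect s) t = facesum (fun r => defect r t) s.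
Proof.
move=> cs; rewrite bdryB bdry_delta facesumB; congr (_ - _).
rewrite bdry_sum facesum_sum.
under eq_bigr do rewrite subdivision_chain_map mulr_sumr.
rewrite exchange_big; apply: eq_bigr => w _.
rewrite facesumMr minvertex_chain_map // mulr_suml.
by apply: eq_bigr => y _; rewrite mulrA.
Qed.

Lemma homotopy_nil t : homotopy [::] t = 0.
Proof. by case: t => //= y t; rewrite mul0r. Qed.

(** By induction on length, W = s - phi psi s - D (d s) is a cycle: d D (d s) equals (1 - phi psi)(d
    s) because d d = 0. Hence the cone over W has boundary W. *)
Lemma homotopyP s t : chain s ->
  bdry (homotopy s) t + facesum (fun r => homotopy r t) s = defect s t.
Proof.
move: {2}(size s).+1 (ltnSn (size s)) => m; elim: m s t => // m IH [|x s] t.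
  by rewrite defect_nil (@eq_bdry _ _ _ (fun=> 0) _ homotopy_nil) bdry0 /= addr0.
rewrite ltnS => zs cs.
pose W r := defect (x :: s) r - facesum (fun q => homotopy q r) (x :: s).
have bW r : bdry W r = 0.
  rewrite bdryB defect_chain_map // bdry_facesum -facesumB.
  rewrite -[RHS](facesum_facesum (fun q => homotopy q r) (x :: s)).
  apply: eq_facesum => i ilt; have [cd _] := chain_del ilt cs.
  rewrite -(IH _ r _ cd); first by rewrite addrAC subrr add0r.
  by rewrite size_del.
rewrite (@eq_bdry _ _ _ (cone x W)) => [|[|y r]] //=.
rewrite bdry_cone (_ : cone x _ t = 0) ?subr0 ?subrK //.
by case: t => //= y t; rewrite bW mulr0.
Qed.

Lemma homotopy_neq0 s t : chain s -> homotopy s t != 0 ->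
  [/\ chain t & top t = top s].
Proof.
elim: t s => [|y t IH] s cs /=; first by rewrite eqxx.
have [->|ns] := eqVneq s [::]; first by rewrite mul0r eqxx.
have [->|] := eqVneq y (top s); last by rewrite mul0r eqxx.
rewrite mul1r => nz; split=> //.
(* The tail comes from D of a face, from [s] itself, or from phi psi [s]; each is a chain inside the
   top of [s]. Repeated entries are allowed, so prepending the top again gives a chain. *)
suff [ct tt] : chain t /\ top t \subset top s.
  rewrite chain_cons ct tt !andbT.
  by case: s ns cs {nz tt} => // x s _; rewrite chain_cons => /andP[].
have [f0|] := eqVneq (facesum (fun r => homotopy r t) s) 0; last first.
  case/facesum_neq0 => i ilt; have [cd ds] := chain_del ilt cs.
  by case/(IH _ cd) => ct ->.
move: nz; rewrite f0 subr0 /defect; case: (s =P t) => [<- //|_]; rewrite sub0r oppr_eq0 => nz.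
have [/existsP[y' /andP[mz sz]]|/existsPn E] :=
    boolP [exists y', (minvertex s y' != 0) && (subdivision y' t != 0)].
  have [_ ys] := minvertex_neq0 cs mz.
  by have [ct -> _] := subdivision_neq0 sz.
case/eqP: nz; apply: big1 => y' _.
by have := E y'; rewrite negb_and !negbK => /orP[]/eqP->; rewrite ?mul0r ?mulr0.
Qed.

End Subsets.

(** * Matrices acting on families with coefficients in the sheaf *)

Section Action.
Variables (R : comPzRingType) (n : nat) (F : sheaf R n).
Local Notation T := {set 'I_n}.

Section Composition.
Variables (I J : finType) (tI : I -> T) (tJ : J -> T).
Implicit Types (z : forall i, sF F (tI i)) (P : pred I) (Q : pred J) (M : I -> J -> R).

Definition act M z : forall j, sF F (tJ j) :=
  fun j => \sum_i M i j *: sres F (tJ j) (tI i) (z i).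

Definition supported P z := forall i, ~~ P i -> z i = 0.

(** The carrier condition: nonzero entries use only genuine restriction maps, those from a subset to
    a smaller one. *)
Definition carried P Q M :=
  forall i j, P i -> M i j != 0 -> Q j && (tJ j \subset tI i).

Lemma act_ext M z z' j : (forall i, z i = z' i) -> act M z j = act M z' j.
Proof. by move=> zz'; apply: eq_bigr => i _; rewrite zz'. Qed.

Lemma eq_act P M M' z j : supported P z ->
  (forall i, P i -> M i j = M' i j) -> act M z j = act M' z j.
Proof.
move=> zP MM'; apply: eq_bigr => i _.
have [/MM'-> //|/zP->] := boolP (P i).
by rewrite linear0 !scaler0.
Qed.

Lemma supported_act P Q M z : carried P Q M -> supported P z ->
  forall j, ~~ Q j -> act M z j = 0.
Proof.
move=> MC zP j Qj; apply: big1 => i _.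
have [Pi|/zP->] := boolP (P i); last by rewrite linear0 scaler0.
have [->|/(MC _ _ Pi)/andP[Qj' _]] := eqVneq (M i j) 0; first exact: scale0r.
by rewrite Qj' in Qj.
Qed.

Lemma actD M M' z j : act (fun i k => M i k + M' i k) z j = act M z j + act M' z j.
Proof. by rewrite -big_split; apply: eq_bigr => i _; rewrite scalerDl. Qed.

Lemma act_linear M c z z' j :
  act M (dadd (dscale c z) z') j = c *: act M z j + act M z' j.
Proof.
rewrite scaler_sumr -big_split; apply: eq_bigr => i _ /=.
by rewrite linearP scalerDr !scalerA mulrC.
Qed.

Lemma actB M z z' j : act M (dsub z z') j = act M z j - act M z' j.
Proof. by rewrite -sumrB; apply: eq_bigr => i _; rewrite linearB scalerBr. Qed.

End Composition.

Lemma act_id (I : finType) (t : I -> T) (z : forall i, sF F (t i)) i :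
  act t (fun i j => (i == j)%:R) z i = z i.
Proof.
rewrite /act (bigD1 i) //= eqxx scale1r sres_id big1 ?addr0 // => j /negPf->.
exact: scale0r.
Qed.

(** Where both entries are nonzero the three subsets are nested, so functoriality composes the
    restrictions; all other terms vanish. *)
Lemma act_comp (I J L : finType) (tI : I -> T) (tJ : J -> T) (tL : L -> T)
  (P : pred I) (Q : pred J) (S : pred L) M N (z : forall i, sF F (tI i)) l :
  supported P z -> carried tI tJ P Q M -> carried tJ tL Q S N ->
  act tL N (act tJ M z) l = act tL (fun i l => \sum_j M i j * N j l) z l.
Proof.
move=> zP MC NC; rewrite /act.
under eq_bigr do rewrite linear_sum scaler_sumr.
rewrite exchange_big; apply: eq_bigr => i _; rewrite scaler_suml.
apply: eq_bigr => j _; rewrite linearZ scalerA mulrC /=.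
have [Pi|/zP->] := boolP (P i); last by rewrite !linear0.
have [->|/(MC _ _ Pi)/andP[Qj ji]] := eqVneq (M i j) 0; first by rewrite mul0r !scale0r.
have [->|/(NC _ _ Qj)/andP[_ lj]] := eqVneq (N j l) 0; first by rewrite mulr0 !scale0r.
by rewrite sres_comp.
Qed.

End Action.

(** * Chains as finite functions and as sequences *)

Section ChainSequences.
Variable n : nat.
Local Notation T := {set 'I_n}.

Definition seq_of m (c : {ffun 'I_m -> T}) : seq T := [seq c i | i <- enum 'I_m].

Lemma size_seq_of m (c : {ffun 'I_m -> T}) : size (seq_of c) = m.
Proof. by rewrite size_map size_enum_ord. Qed.

Lemma nth_seq_of m (c : {ffun 'I_m -> T}) (i : 'I_m) : nth set0 (seq_of c) i = c i.
Proof. by rewrite (nth_map i) ?size_enum_ord // nth_ord_enum. Qed.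

Lemma seq_of_inj m : injective (@seq_of m).
Proof. by move=> c c' E; apply/ffunP => i; rewrite -!nth_seq_of E. Qed.

Lemma seq_ofS m (c : {ffun 'I_m.+1 -> T}) :
  seq_of c = c ord0 :: seq_of [ffun i => c (lift ord0 i)].
Proof.
rewrite /seq_of enum_ordSl /= -map_comp; congr (_ :: _).
by apply: eq_map => i; rewrite /= ffunE.
Qed.

Lemma top_seq_of k (c : schain n k) : top (seq_of c) = c ord0.
Proof. by rewrite seq_ofS. Qed.

Lemma sum_seq_of (R : comPzRingType) m (g : seq T -> R) :
  \sum_(c : {ffun 'I_m -> T}) g (seq_of c) = ssum m g.
Proof.
elim: m g => [|m IH] g /=.
  have c0 : {ffun 'I_0 -> T} by apply: finfun => -[].
  rewrite (big_pred1 c0) => [|c]; last by apply/esym/eqP/ffunP => -[].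
  by congr g; apply/size0nil/size_seq_of.
(* The bijection that prepends a head to a function, matching the recursion of [ssum]. *)
pose h (p : T * {ffun 'I_m -> T}) : {ffun 'I_m.+1 -> T} :=
  [ffun i => if unlift ord0 i is Some j then p.2 j else p.1].
have hE x c : seq_of (h (x, c)) = x :: seq_of c.
  rewrite seq_ofS ffunE unlift_none; congr (_ :: seq_of _).
  by apply/ffunP => i; rewrite !ffunE liftK.
rewrite (reindex h); last first.
  exists (fun c : {ffun 'I_m.+1 -> T} => (c ord0, [ffun i => c (lift ord0 i)])) => [[x c] _|c _].
    rewrite ffunE unlift_none; congr (_, _).
    by apply/ffunP => i; rewrite !ffunE liftK.
  by apply/ffunP => i; rewrite ffunE; case: unliftP => [j|] -> //=; rewrite ffunE.
rewrite -(pair_big xpredT xpredT (fun x c => g (seq_of (h (x, c))))) /=.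
by apply: eq_bigr => x _; rewrite -IH; apply: eq_bigr => c _; rewrite hE.
Qed.

(** Transitivity of inclusion reduces the condition on all pairs to consecutive entries. *)
Lemma is_chainE k (c : schain n k) : is_chain c = chain (seq_of c).
Proof.
have tr : transitive (fun x y : T => y \subset x).
  by move=> y x z yx zy; apply: subset_trans yx.
congr (_ && _).
  apply/forallP/allP => [cn0 x /mapP[i _ ->] //|cn0 i].
  by apply: cn0; apply: map_f; rewrite mem_enum.
apply/forallP/(sortedP set0) => [E i|E i].
  rewrite size_seq_of => ilt.
  have /forallP/(_ (Ordinal ilt)) := E (Ordinal (ltnW ilt)).
  by rewrite -!nth_seq_of /= leqnSn.
apply/forallP => j; apply/implyP => ij; rewrite -!nth_seq_of.
have sc : sorted (fun x y : T => y \subset x) (seq_of c) by apply/(sortedP set0).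
by apply: (sorted_leq_nth tr (fun x => subxx x) set0 sc); rewrite ?inE ?size_seq_of.
Qed.

Lemma seq_of_face k (i : 'I_k.+2) (c : schain n k.+1) :
  seq_of (face i c) = del i (seq_of c).
Proof.
have ilt : (i < size (seq_of c))%N by rewrite size_seq_of.
apply: (@eq_from_nth _ set0) => [|j].
  by apply: succn_inj; rewrite size_del // !size_seq_of.
rewrite size_seq_of => jlt; rewrite -[j]/(val (Ordinal jlt)) nth_seq_of ffunE.
rewrite -nth_seq_of nth_cat size_takel ?(ltnW ilt) //= /bump.
case: ltnP => ji; first by rewrite nth_take // leqNgt ji.
by rewrite nth_drop addSn subnKC // add1n.
Qed.

End ChainSequences.

(** * The maps psi, phi and D between the two complexes of the sheaf *)

Section Comparison.
Variables (R : comPzRingType) (n : nat) (F : sheaf R n).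
Local Notation T := {set 'I_n}.

Definition schain_top k (c : schain n k) : T := c ord0.

Definition sized k (y : T) := #|y| == k.+1.

Definition face_matrix k (c : schain n k.+1) (t : schain n k) : R :=
  facesum (fun r => (r == seq_of t)%:R) (seq_of c).

Definition minvertex_matrix k (c : schain n k) (y : T) : R := minvertex R (seq_of c) y.

Definition subdivision_matrix k (y : T) (c : schain n k) : R := subdivision R y (seq_of c).

Definition homotopy_matrix k (c : schain n k) (t : schain n k.+1) : R :=
  homotopy R (seq_of c) (seq_of t).

Lemma face_matrix_carried k : carried (@schain_top k.+1) (@schain_top k)
  (@is_chain n k.+1) (@is_chain n k) (@face_matrix k).
Proof.
move=> c t; rewrite is_chainE => cc /facesum_neq0[i ilt].
have [cd ds] := chain_del ilt cc; rewrite is_chainE /schain_top -!top_seq_of.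
by case: (_ =P seq_of t) => [<-|_]; rewrite ?cd ?eqxx.
Qed.

Lemma incidence_carried k : carried (@id T) (@id T) (sized k.+1) (sized k) (@incidence R n).
Proof.
move=> y w /eqP zy nz.
have [/existsP[a /andP[ya /eqP->]]|/existsPn E] := boolP [exists a, (a \in y) && (w == y :\ a)].
  by move: zy; rewrite (cardsD1 a) ya add1n => -[E]; rewrite /sized E eqxx subD1set.
by case/eqP: nz; apply: big_pred0 => a; apply/negbTE/E.
Qed.

Lemma minvertex_carried k :
  carried (@schain_top k) id (@is_chain n k) (sized k) (@minvertex_matrix k).
Proof.
move=> c y; rewrite is_chainE => cc /(minvertex_neq0 cc)[].
by rewrite size_seq_of top_seq_of /sized => /eqP->.
Qed.

Lemma subdivision_carried k :
  carried id (@schain_top k) (sized k) (@is_chain n k) (@subdivision_matrix k).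
Proof.
move=> y c _ /subdivision_neq0[cc tc _].
by rewrite is_chainE cc /schain_top -top_seq_of tc subxx.
Qed.

Lemma homotopy_carried k : carried (@schain_top k) (@schain_top k.+1)
  (@is_chain n k) (@is_chain n k.+1) (@homotopy_matrix k).
Proof.
move=> c t; rewrite !is_chainE => cc /(homotopy_neq0 cc)[ct tt].
by rewrite ct /schain_top -!top_seq_of tt subxx.
Qed.

(** [Sd] sums over chains only, the matrix over all functions; on a supported family the extra terms
    are 0. *)
Lemma SdE k (z : Selt F k.+1) t : S_supp z ->
  Sd z t = act (@schain_top k) (@face_matrix k) (z : forall c, sF F (schain_top c)) t.
Proof.
move=> zS; rewrite /Sd /act.
under eq_bigr do rewrite big_mkcond.
rewrite exchange_big; apply: eq_bigr => c _.
have [cc|/zS->] := boolP (is_chain c); last first.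
  by rewrite linear0 scaler0 big1.
rewrite /face_matrix facesumE size_seq_of scaler_suml; apply: eq_bigr => i _.
rewrite /= -seq_of_face (inj_eq (@seq_of_inj n k.+1)).
by case: eqP => _ /=; rewrite ?mulr1 // mulr0 scale0r.
Qed.

Lemma CdE k (z : Celt F) w : C_supp k.+1 z ->
  Cd k z w = act id (@incidence R n) (z : forall y, sF F (id y)) w.
Proof.
move=> zC; rewrite /Cd /act big_mkcond; apply: eq_bigr => y _.
case: eqP => [_|/eqP/zC->]; last by rewrite linear0 scaler0.
by rewrite scaler_suml.
Qed.

Definition psi k (z : Selt F k) : Celt F :=
  act id (@minvertex_matrix k) (z : forall c, sF F (schain_top c)).

Definition phi k (z : Celt F) : Selt F k :=
  act (@schain_top k) (@subdivision_matrix k) (z : forall y, sF F (id y)).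

Arguments phi k z : clear implicits.

Definition hmap k (z : Selt F k) : Selt F k.+1 :=
  act (@schain_top k.+1) (@homotopy_matrix k) (z : forall c, sF F (schain_top c)).

Lemma psi_supp k (z : Selt F k) : S_supp z -> C_supp k (psi z).
Proof. by move=> zS; apply: supported_act (@minvertex_carried k) zS. Qed.

Lemma phi_supp k (z : Celt F) : C_supp k z -> S_supp (phi k z).
Proof. by move=> zC; apply: supported_act (@subdivision_carried k) zC. Qed.

Lemma hmap_supp k (z : Selt F k) : S_supp z -> S_supp (hmap z).
Proof. by move=> zS; apply: supported_act (@homotopy_carried k) zS. Qed.

Lemma sum_face_matrix k (c : schain n k.+1) (g : seq T -> R) :
  \sum_t face_matrix c t * g (seq_of t) = facesum g (seq_of c).
Proof.
rewrite (sum_seq_of k.+1 (fun s => facesum (fun r => (r == s)%:R) (seq_of c) * g s)).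
by rewrite seq_ofS -[RHS]ssum_facesum size_seq_of.
Qed.

Lemma sum_face_matrix_bdry k (w : seq T -> R) (t : schain n k) :
  \sum_c w (seq_of c) * face_matrix c t = bdry w (seq_of t).
Proof.
rewrite (sum_seq_of k.+2 (fun s => w s * facesum (fun r => (r == seq_of t)%:R) s)).
by rewrite -[RHS]ssum_bdry size_seq_of.
Qed.

(** The pattern for all identities below: merge each side into one matrix by [act_comp], compare
    rows in the support, and conclude by the identity on sequences. *)
Lemma psi_Sd k (z : Selt F k.+1) w : S_supp z -> Cd k (psi z) w = psi (Sd z) w.
Proof.
move=> zS; rewrite CdE; last exact: psi_supp.
rewrite (act_comp _ zS (@minvertex_carried _) (@incidence_carried _)).
rewrite [RHS](act_ext _ _ _ (fun t => SdE t zS)).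
rewrite (act_comp _ zS (@face_matrix_carried _) (@minvertex_carried _)).
apply: eq_act zS _ => c cc.
rewrite (sum_face_matrix c (fun s => minvertex R s w)) minvertex_chain_map //.
by rewrite -is_chainE.
Qed.

Lemma phi_Cd k (z : Celt F) t : C_supp k.+1 z -> Sd (phi k.+1 z) t = phi k (Cd k z) t.
Proof.
move=> zC; rewrite SdE; last exact: phi_supp.
rewrite (act_comp _ zC (@subdivision_carried _) (@face_matrix_carried _)).
rewrite [RHS](act_ext _ _ _ (fun w => CdE w zC)).
rewrite (act_comp _ zC (@incidence_carried _) (@subdivision_carried _)).
apply: (eq_act (@schain_top k)) zC _ => y _.
by rewrite (sum_face_matrix_bdry (subdivision R y)) subdivision_chain_map.
Qed.

Lemma phiK k (z : Celt F) w : C_supp k z -> psi (phi k z) w = z w.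
Proof.
move=> zC; rewrite /psi (act_comp _ zC (@subdivision_carried _) (@minvertex_carried _)).
rewrite -[RHS](act_id (z : forall y, sF F (id y))).
apply: eq_act zC _ => y /eqP zy.
rewrite (sum_seq_of k.+1 (fun s => subdivision R y s * minvertex R s w)) -zy.
exact: minvertex_subdivision.
Qed.

(** The term D d stays a [facesum], because for [k = 0] the face is the empty sequence, which no
    [schain] represents. *)
Lemma phi_psi_coef k (c t : schain n k) : is_chain c ->
  (c == t)%:R = \sum_y minvertex_matrix c y * subdivision_matrix y t +
    (\sum_s homotopy_matrix c s * face_matrix s t +
     facesum (fun r => homotopy R r (seq_of t)) (seq_of c)).
Proof.
rewrite is_chainE => cc.
rewrite (sum_face_matrix_bdry (homotopy R (seq_of c))) homotopyP //.
by rewrite /defect (inj_eq (@seq_of_inj n k.+1)) addrC subrK.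
Qed.

Lemma hmap0 (z : Selt F 0) t : S_supp z -> z t = phi 0 (psi z) t + Sd (hmap z) t.
Proof.
move=> zS; rewrite SdE; last exact: hmap_supp.
rewrite /phi (act_comp _ zS (@minvertex_carried _) (@subdivision_carried _)).
rewrite (act_comp _ zS (@homotopy_carried _) (@face_matrix_carried _)).
rewrite -(@actD _ _ F _ _ _ (@schain_top 0)).
rewrite -[LHS](act_id (z : forall c, sF F (schain_top c))).
apply: (eq_act (@schain_top 0)) zS _ => c cc; rewrite (phi_psi_coef _ cc); congr (_ + _).
have -> : seq_of c = [:: c ord0] by rewrite seq_ofS (size0nil (size_seq_of _)).
by rewrite /= homotopy_nil subr0 addr0.
Qed.

Lemma hmapS k (z : Selt F k.+1) t : S_supp z ->
  z t = phi k.+1 (psi z) t + (Sd (hmap z) t + hmap (Sd z) t).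
Proof.
move=> zS; rewrite SdE; last exact: hmap_supp.
rewrite [X in _ + (_ + X)](act_ext _ _ _ (fun t => SdE t zS)).
rewrite /phi (act_comp _ zS (@minvertex_carried _) (@subdivision_carried _)).
rewrite (act_comp _ zS (@homotopy_carried _) (@face_matrix_carried _)).
rewrite (act_comp _ zS (@face_matrix_carried _) (@homotopy_carried _)).
rewrite -!(@actD _ _ F _ _ _ (@schain_top k.+1)).
rewrite -[LHS](act_id (z : forall c, sF F (schain_top c))).
apply: (eq_act (@schain_top k.+1)) zS _ => c cc.
rewrite (phi_psi_coef _ cc); do 2!congr (_ + _).
by rewrite (sum_face_matrix c (fun r => homotopy R r (seq_of t))).
Qed.

Lemma hmap_cycle k (z : Selt F k) t : SZ z -> z t = phi k (psi z) t + Sd (hmap z) t.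
Proof.
case: k z t => [|k] z t [zS]; first by move=> _; apply: hmap0.
move=> dz; rewrite [LHS]hmapS //.
rewrite [X in _ + (_ + X)](_ : _ = 0) ?addr0 //.
by apply: big1 => c _; rewrite dz linear0 scaler0.
Qed.

End Comparison.

Arguments phi {R n F} k z.

(** * The isomorphism on homology induced by psi *)

Theorem theorem4 (R : comPzRingType) (n : nat) (F : sheaf R n) (k : nat) :
  hiso (@SZ R n F k) (@SB R n F k) (@CZ R n F k) (@CB R n F k).
Proof.
have SBP (z : Selt F k) : SZ z -> SB z <-> CB k (psi z).
  move=> zZ; split=> [[y [yS dy]]|[y [yC dy]]].
    exists (psi y); split; first exact: psi_supp.
    by move=> w; rewrite psi_Sd //; apply: act_ext.
  (* If psi z = d y, then z = phi psi z + d D z = d (phi y + D z). *)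
  exists (dadd (phi k.+1 y) (hmap z)); split=> [c nc|t].
    by rewrite /dadd phi_supp // hmap_supp ?addr0 //; case: zZ.
  rewrite [RHS](hmap_cycle _ zZ).
  have -> : phi k (psi z) t = phi k (Cd k y) t 
    by apply: (act_ext (@schain_top n k)) => w; rewrite dy.
  rewrite -phi_Cd // /Sd -big_split; apply: eq_bigr => i _.
  by rewrite -big_split; apply: eq_bigr => s _; rewrite linearD scalerDr.
have ZB (z z' : Selt F k) : SZ z -> SZ z' -> SZ (dsub z z').
  move=> [zS dz] [z'S dz']; split=> [c nc|]; first by rewrite /dsub zS ?z'S ?subr0.
  case: k z z' zS dz z'S dz' {SBP} => // k' z z' zS dz z'S dz' t.
  rewrite -[RHS]subr0 -{1}(dz t) -(dz' t) /Sd -sumrB; apply: eq_bigr => i _.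
  by rewrite -sumrB; apply: eq_bigr => s _; rewrite linearB scalerBr.
exists (@psi R n F k); split.
- move=> z [zS dz]; split; first exact: psi_supp.
  case: k z zS dz {SBP ZB} => // k' z zS dz w.
  by rewrite psi_Sd //; apply: big1 => c _; rewrite dz linear0 scaler0.
- move=> z z' zZ z'Z; rewrite SBP; last exact: ZB.
  have E w : psi (dsub z z') w = dsub (psi z) (psi z') w by apply: actB.
  by split=> -[y [yC dy]]; exists y; split=> // w; rewrite dy E.
(* psi is linear on representatives, so the difference is the boundary of 0. *)
- move=> a z z' _ _; exists (fun=> 0); split=> // w.
  rewrite /dsub /dadd /dscale -act_linear subrr /Cd.
  by apply: big1 => y _; apply: big1 => b _; rewrite linear0 scaler0.
(* psi phi = id makes phi y an exact preimage of the cycle y. *)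
- move=> y [yC dy]; exists (phi k y).
    split; first exact: phi_supp.
    case: k yC dy {SBP ZB} => // k' yC dy t.
    by rewrite phi_Cd //; apply: big1 => c _; rewrite dy linear0 scaler0.
  exists (fun=> 0); split=> // w; rewrite /dsub phiK // subrr /Cd.
  by apply: big1 => v _; apply: big1 => b _; rewrite linear0 scaler0.
Qed.
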